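(* Let $x$ and $y$ be two variables with $x \neq y$. Then there exists a prelambda congruence $\sim$ on $\mathbb{T}$ such that $\lambda x x \not\sim \lambda y y$ (i.e. $([\lambda x x],[\lambda y y]) \notin\, \sim$).
   Context: Let $\mathbb{V}$ be an infinite set whose elements are called variables. The set $\mathbb{T}$ of terms is the set of words inductively defined by: every variable $x$ is a term; if $A,B$ are terms then $[AB]$ is a term (application); if $x$ is a variable and $A$ is a term then $[\lambda x A]$ is a term (abstraction). Equality of terms is syntactic identity of words (no identification up to renaming of bound variables). We abbreviate $[AB]$ as $AB$ and $[\lambda x A]$ as $\lambda x A$. A binary relation $\sim$ on $\mathbb{T}$ is a congruence if it is reflexive, symmetric, transitive, and for all terms $A,B,C,D$ and every variable $x$: $A\sim B$ implies $\lambda x A \sim \lambda x B$, and $A\sim B$, $C \sim D$ imply $AC \sim BD$. A prelambda congruence is a congruence $\sim$ such that for all terms $A,B,D$ and all variables $x,y$: ($\beta_1$) $[\lambda x x]D \sim D$; ($\beta_2$) $[\lambda x y]D \sim y$ whenever $x\neq y$; ($\beta_3$) $[\lambda x[AB]]D \sim [[\lambda x A]D][[\lambda x B]D]$; ($\beta_4$) $[\lambda x[\lambda x A]]D \sim \lambda x A$; ($\beta_5$) if $x \neq y$ and $[\lambda y D]x \sim D$, then $[\lambda x[\lambda y A]]D \sim \lambda y[[\lambda x A]D]$. *)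

(* Defs.v *)
From Stdlib Require Export Ensembles Finite_sets RelationClasses.

Set Implicit Arguments.
Unset Strict Implicit.

(* The bracketed words are uniquely readable, so they are represented by their
   syntax trees. Bound variables are named, and equality of terms is [=]:
   there is no quotient by alpha-conversion. *)
Inductive term (V : Type) : Type :=
| Var (x : V)
| App (A B : term V)
| Lam (x : V) (A : term V).

Definition infinite_type (V : Type) : Prop := ~ Finite V (Full_set V).

Record congruence (V : Type) (R : term V -> term V -> Prop) : Prop := {
  cong_equiv : Equivalence R;
  cong_lam : forall (x : V) (A B : term V), R A B -> R (Lam x A) (Lam x B);
  cong_app : forall A B C D : term V, R A B -> R C D -> R (App A C) (App B D)
}.

Record prelambda_congruence (V : Type) (R : term V -> term V -> Prop) : Prop := {
  prelambda_cong : congruence R;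
  beta1 : forall (x : V) (D : term V), R (App (Lam x (Var x)) D) D;
  beta2 : forall (x y : V) (D : term V),
    x <> y -> R (App (Lam x (Var y)) D) (Var y);
  beta3 : forall (x : V) (A B D : term V),
    R (App (Lam x (App A B)) D) (App (App (Lam x A) D) (App (Lam x B) D));
  beta4 : forall (x : V) (A D : term V),
    R (App (Lam x (Lam x A)) D) (Lam x A);
  beta5 : forall (x y : V) (A D : term V),
    x <> y -> R (App (Lam y D) (Var x)) D ->
    R (App (Lam x (Lam y A)) D) (Lam y (App (Lam x A) D))
}.

(* Main.v *)
Require Import Defs.
From Stdlib Require Import List Classical FunctionalExtensionality PropExtensionality.
Import ListNotations.

Set Implicit Arguments.
Unset Strict Implicit.

(** Terms are interpreted in a graph model: values are sets of points, and a
    point [Arr a b] of a function says that [b] belongs to its value as soon as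
    the finite set [a] is included in the argument. The model is far from
    extensional: atomic points are ignored by application, so each abstraction
    can carry, besides its graph, the name of its bound variable as an atom.
    Tagging does not disturb the five axioms, but it separates [λx x] from
    [λy y]. *)

Inductive point (V : Type) : Type :=
| Atom (x : V)
| Arr (a : list (point V)) (b : point V).

Definition value (V : Type) : Type := point V -> Prop.

Definition apply (V : Type) (f d : value V) : value V :=
  fun b => exists a, f (Arr a b) /\ forall e, In e a -> d e.

Definition finite_value (V : Type) (a : list (point V)) : value V :=
  fun e => In e a.

(* Relational, because equality on [V] need not be decidable. *)
Definition update (V : Type) (r : V -> value V) (x : V) (d : value V) :
    V -> value V :=
  fun z e => (x = z /\ d e) \/ (x <> z /\ r z e).

Fixpoint eval (V : Type) (A : term V) (r : V -> value V) : value V :=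
  match A with
  | Var x => r x
  | App A B => apply (eval A r) (eval B r)
  | Lam x A => fun e =>
      match e with
      | Atom z => z = x
      | Arr a b => eval A (update r x (finite_value a)) b
      end
  end.

Lemma value_ext (V : Type) (d d' : value V) :
  (forall e, d e <-> d' e) -> d = d'.
Proof.
  intros H; apply functional_extensionality; intros e.
  now apply propositional_extensionality.
Qed.

Lemma env_ext (V : Type) (r r' : V -> value V) :
  (forall z e, r z e <-> r' z e) -> r = r'.
Proof.
  intros H; apply functional_extensionality; intros z.
  now apply value_ext.
Qed.

Lemma update_same (V : Type) (r : V -> value V) x d : update r x d x = d.
Proof. apply value_ext; intros e; unfold update; tauto. Qed.

Lemma update_other (V : Type) (r : V -> value V) x y d :
  x <> y -> update r x d y = r y.
Proof. intros H; apply value_ext; intros e; unfold update; tauto. Qed.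

Lemma update_update (V : Type) (r : V -> value V) x d d' :
  update (update r x d) x d' = update r x d'.
Proof. apply env_ext; intros z e; unfold update; tauto. Qed.

Lemma update_comm (V : Type) (r : V -> value V) x y d d' :
  x <> y -> update (update r x d) y d' = update (update r y d') x d.
Proof.
  intros H; apply env_ext; intros z e; unfold update.
  destruct (classic (x = z)) as [<-|]; [|tauto].
  assert (y <> x) by congruence; tauto.
Qed.

(** Environments are consulted only positively: [apply] asks for membership in both of its
    arguments, and the list in an [Arr] point is fixed beforehand. *)
Lemma eval_mono (V : Type) (A : term V) : forall r r' : V -> value V,
  (forall z e, r z e -> r' z e) -> forall b, eval A r b -> eval A r' b.
Proof.
  induction A as [z|A IHA B IHB|z A IHA]; simpl; intros r r' H b.
  - apply H.
  - intros [a [Ha Hsub]]; exists a; eauto.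
  - destruct b as [t|a b]; [easy|].
    apply IHA; intros u e; unfold update; intuition.
Qed.

Lemma eval_update_mono (V : Type) (A : term V) (r : V -> value V) x
    (d d' : value V) b :
  (forall e, d e -> d' e) ->
  eval A (update r x d) b -> eval A (update r x d') b.
Proof. intros H; apply eval_mono; intros z e; unfold update; intuition. Qed.

(** Finitely many finite approximations of [d] are merged by concatenation, and monotonicity keeps
    each point of [l]. An application needs this because it consumes a whole list of points of its
    argument. *)
Lemma eval_list_continuous (V : Type) (A : term V) (r : V -> value V) x d :
  (forall b, eval A (update r x d) b ->
     exists a, (forall e, In e a -> d e) /\
               eval A (update r x (finite_value a)) b) ->
  forall l, (forall b, In b l -> eval A (update r x d) b) ->
  exists a, (forall e, In e a -> d e) /\
    forall b, In b l -> eval A (update r x (finite_value a)) b.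
Proof.
  intros H; induction l as [|c l IHl]; intros Hl.
  - exists []; simpl; tauto.
  - destruct (H c) as [a1 [Hd1 H1]]; [now apply Hl; left|].
    destruct IHl as [a2 [Hd2 H2]]; [now intros b Hb; apply Hl; right|].
    exists (a1 ++ a2); split.
    + intros e He; apply in_app_or in He as []; auto.
    + intros b [<-|Hb].
      * revert H1; apply eval_update_mono; intros e He.
        now apply in_or_app; left.
      * generalize (H2 b Hb); apply eval_update_mono; intros e He.
        now apply in_or_app; right.
Qed.

(** Producing one point consults [d] only finitely often. The environment stays general because
    under a binder the induction hypothesis is used with the bound variable already set to a finite
    value. *)
Lemma eval_continuous (V : Type) (A : term V) :
  forall (r : V -> value V) x (d : value V) b, eval A (update r x d) b ->
  exists a, (forall e, In e a -> d e) /\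
    eval A (update r x (finite_value a)) b.
Proof.
  induction A as [z|A IHA B IHB|z A IHA]; simpl; intros r x d b.
  - intros [[E Hb]|[N Hb]].
    + exists [b]; split; [now intros e [<-|[]]|left; split; [easy|now left]].
    + exists []; split; [easy|now right].
  - intros [l [HA HB]].
    destruct (IHA _ _ _ _ HA) as [a1 [Hd1 H1]].
    destruct (eval_list_continuous (IHB r x d) HB) as [a2 [Hd2 H2]].
    exists (a1 ++ a2); split.
    + intros e He; apply in_app_or in He as []; auto.
    + exists l; split.
      * revert H1; apply eval_update_mono; intros e He.
        now apply in_or_app; left.
      * intros e He; generalize (H2 e He); apply eval_update_mono.
        intros e' He'; now apply in_or_app; right.
  - destruct b as [t|l b]; [now exists []|].
    destruct (classic (x = z)) as [<-|N].
    (* The inner binder shadows [x], so [d] is never consulted. *)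
    + rewrite update_update; exists []; split; [easy|].
      now rewrite update_update.
    + rewrite (update_comm _ _ _ N); intros H.
      destruct (IHA _ _ _ _ H) as [a [Hd Ha]].
      exists a; split; [easy|].
      now rewrite (update_comm _ _ _ N).
Qed.

(** One inclusion is monotonicity, from a finite part of [d] up to [d]; the other is continuity. The
    tag of the abstraction is invisible to [apply]. *)
Lemma eval_beta (V : Type) (x : V) (A : term V) (r : V -> value V) d :
  apply (eval (Lam x A) r) d = eval A (update r x d).
Proof.
  apply value_ext; intros b; split.
  - intros [a [Ha Hd]]; revert Ha; simpl; now apply eval_update_mono.
  - intros H; destruct (eval_continuous H) as [a [Hd Ha]]; now exists a.
Qed.

(* Evaluating the hypothesis in [r] and in [update r y d] yields on the left the
   same value, namely that of [D] in [update r y (r x)]. *)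
Lemma eval_independent (V : Type) (x y : V) (D : term V) :
  x <> y -> (forall r, eval (App (Lam y D) (Var x)) r = eval D r) ->
  forall r d, eval D (update r y d) = eval D r.
Proof.
  intros N H r d.
  assert (H' : forall s, eval D (update s y (s x)) = eval D s)
    by (intros s; rewrite <- (H s); symmetry; apply eval_beta).
  rewrite <- (H' r), <- (H' (update r y d)), update_update, update_other;
    congruence.
Qed.

Lemma eval_prelambda_congruence (V : Type) :
  prelambda_congruence (fun A B : term V => forall r, eval A r = eval B r).
Proof.
  split; [split; [split|..]|..].
  - now intros A r.
  - now intros A B H r.
  - intros A B C H H' r; now rewrite H.
  - intros x A B H r; apply value_ext; intros [z|a b]; simpl; [easy|].
    now rewrite H.
  - intros A B C D H H' r; simpl; now rewrite H, H'.
  - intros x D r; etransitivity; [apply eval_beta|apply update_same].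
  - intros x y D N r; etransitivity; [apply eval_beta|now apply update_other].
  - intros x A B D r; etransitivity; [apply eval_beta|].
    change (apply (eval A (update r x (eval D r))) (eval B (update r x (eval D r)))
      = apply (apply (eval (Lam x A) r) (eval D r))
          (apply (eval (Lam x B) r) (eval D r))).
    now rewrite !eval_beta.
  - intros x A D r; etransitivity; [apply eval_beta|].
    apply value_ext; intros [z|a b]; simpl; [easy|].
    now rewrite update_update.
  - intros x y A D N H r; etransitivity; [apply eval_beta|].
    (* Both sides are tagged with [y], whatever the environment, so only [Arr] points remain. *)
    apply value_ext; intros [z|a b]; [easy|].
    change (eval A (update (update r x (eval D r)) y (finite_value a)) b <->
      apply (eval (Lam x A) (update r y (finite_value a)))
        (eval D (update r y (finite_value a))) b).
    (* The premise of the fifth axiom makes the value of [D] insensitive to [y], so no capture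
       occurs. *)
    now rewrite eval_beta, (eval_independent N H), (update_comm _ _ _ N).
Qed.

Theorem theorem3p3 (V : Type) (infV : infinite_type V) (x y : V) (hxy : x <> y) :
  exists R : term V -> term V -> Prop,
    prelambda_congruence R /\ ~ R (Lam x (Var x)) (Lam y (Var y)).
Proof.
  exists (fun A B => forall r, eval A r = eval B r).
  split; [apply eval_prelambda_congruence|].
  intros H; apply hxy.
  (* Membership of [Atom x] in the value of [Lam y (Var y)] computes to [x = y], and in that of
     [Lam x (Var x)] to [x = x]. Any environment would serve. *)
  change (eval (Lam y (Var y)) (fun _ _ => False) (Atom x)).
  now rewrite <- H.
Qed.
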